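(* Let $r\geq 1$ and let $\alpha_1,\dots,\alpha_r$ be real numbers such that $1,\alpha_1,\dots,\alpha_r$ are linearly independent over $\mathbb{Q}$. Let $m_\nu=(m_{0,\nu},m_{1,\nu},\dots,m_{r,\nu})\in\mathbb{Z}^{r+1}$, $\nu=1,2,3,\ldots$, be the sequence of best approximations for $(\alpha_1,\dots,\alpha_r)$, and put $\zeta_\nu=m_{0,\nu}+m_{1,\nu}\alpha_1+\dots+m_{r,\nu}\alpha_r$ and $M_\nu=\max_{1\leq j\leq r}|m_{j,\nu}|$. Take an integer $k\geq 1$ and consider the integer points \[ m_\nu^*=(m_{0,\nu},m_{1,\nu},\dots,m_{r,\nu},\underbrace{0,\ldots,0}_{k})\in\mathbb{Z}^{r+k+1},\quad \nu=1,2,3,\ldots \] Put $\delta_k=1$ if $k=1$ and $\delta_k=0$ if $k\geq 2$. Suppose that the series \[ \sum_{\nu=1}^\infty M_{\nu+1}^{r+k}(\log M_{\nu+1})^{\delta_k}\zeta_\nu \] converges. Then for almost all $(\beta_1,\ldots,\beta_k)\in\mathbb{R}^k$ (with respect to Lebesgue measure) the sequence of best approximations for the $(r+k)$-tuple $(\alpha_1,\ldots,\alpha_r,\beta_1,\ldots,\beta_k)$ differs from the sequence $(m_\nu^* )_{\nu\geq1}$ by at most a finite set of integer points.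
   Context: For real numbers $\gamma_1,\dots,\gamma_s$ and $n=(n_0,n_1,\dots,n_s)\in\mathbb{Z}^{s+1}$ write $\zeta(n)=n_0+n_1\gamma_1+\dots+n_s\gamma_s$, and let $\|x\|$ denote the distance from $x$ to the nearest integer. A point $m=(m_0,\dots,m_s)\in\mathbb{Z}^{s+1}\setminus\{0\}$ is a best approximation (in the sense of linear form) for $(\gamma_1,\dots,\gamma_s)$ if $\zeta(m)=\min_n\|\zeta(n)\|$, the minimum taken over all $n\in\mathbb{Z}^{s+1}$ with $0<\max_{1\leq j\leq s}|n_j|\leq\max_{1\leq j\leq s}|m_j|$ (so of each pair $\pm m$ the one with $\zeta(m)>0$ is chosen). When $1,\gamma_1,\dots,\gamma_s$ are linearly independent over $\mathbb{Q}$, the best approximations form a sequence $m_1,m_2,\dots$ ordered so that $\max_{1\leq j\leq s}|m_{j,\nu}|$ is strictly increasing in $\nu$; then the values $\zeta(m_\nu)$ are strictly decreasing. *)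

(* Defs.v *)
From HB Require Import structures.
From mathcomp Require Import all_boot all_order all_algebra.
From mathcomp Require Import all_classical all_reals all_analysis.

Set Implicit Arguments.
Unset Strict Implicit.
Unset Printing Implicit Defensive.

Import Order.TTheory GRing.Theory Num.Theory.
Import numFieldNormedType.Exports.

Local Open Scope classical_set_scope.
Local Open Scope ring_scope.

Definition lin_indep_Q (R : realType) (s : nat) (g : s.-tuple R) : Prop :=
  forall q : s.+1.-tuple rat,
    ratr (tnth q ord0) + \sum_(j < s) ratr (tnth q (lift ord0 j)) * tnth g j = 0 ->
  forall j, tnth q j = 0.

(* Entry [ord0] is the integer n_0; the other entries, indexed by [lift ord0 j],
   are the coefficients of the numbers g_j. *)
Definition zeta (R : realType) (s : nat) (g : s.-tuple R)
    (n : s.+1.-tuple int) : R :=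
  (tnth n ord0)%:~R + \sum_(j < s) (tnth n (lift ord0 j))%:~R * tnth g j.

(* The entry n_0 is deliberately left out of the maximum. *)
Definition height (s : nat) (n : s.+1.-tuple int) : nat :=
  \max_(j < s) `|tnth n (lift ord0 j)|%N.

Definition dist_int (R : realType) (x : R) : R :=
  inf [set `|x - z%:~R| | z in [set: int]].

(* The second and third clauses say that [zeta g m] is the minimum of
   [dist_int (zeta g n)] over the points n with 0 < height n <= height m:
   it is attained, and it is a lower bound. *)
Definition best_approx (R : realType) (s : nat) (g : s.-tuple R)
    (m : s.+1.-tuple int) : Prop :=
  [/\ exists j, tnth m j <> 0,
      exists2 n : s.+1.-tuple int,
        (0 < height n <= height m)%N & zeta g m = dist_int (zeta g n)
    & forall n : s.+1.-tuple int,
        (0 < height n <= height m)%N -> zeta g m <= dist_int (zeta g n)].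

(* Sequences are indexed from 0, so that [m nu] is the point m_(nu+1). *)
Definition best_approx_seq (R : realType) (s : nat) (g : s.-tuple R)
    (m : nat -> s.+1.-tuple int) : Prop :=
  range m = [set n | best_approx g n] /\
  (forall nu, (height (m nu) < height (m nu.+1))%N).

Definition pad0 (r k : nat) (m : r.+1.-tuple int) : (r + k).+1.-tuple int :=
  cat_tuple m (nseq_tuple k 0).

Section lebesgue_tuple.
Variable R : realType.
Local Notation T := (measurableTypeR R).
Local Open Scope ereal_scope.

Definition cons_pair (k : nat) (p : T * k.-tuple T) : k.+1.-tuple T :=
  cons_tuple p.1 p.2.

(* k-dimensional Lebesgue measure on the Borel sets of R^k = [k.-tuple R]: the
   iterated product of [lebesgue_measure], with a point mass on R^0. *)
Fixpoint lebesgue_tuple (k : nat) : set (k.-tuple T) -> \bar R :=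
  match k return set (k.-tuple T) -> \bar R with
  | 0%N => \d_([tuple] : 0.-tuple T)
  | k'.+1 =>
      pushforward (lebesgue_measure \x @lebesgue_tuple k') (@cons_pair k')
  end.

Lemma measurable_cons_pair k : measurable_fun setT (@cons_pair k).
Proof. exact: measurable_cons. Qed.

Definition uncons (k : nat) (x : k.+1.-tuple T) : T * k.-tuple T :=
  (thead x, behead_tuple x).

Lemma measurable_uncons k : measurable_fun setT (@uncons k).
Proof.
have m1 : measurable_fun setT (fun x : k.+1.-tuple T => tnth x ord0).
  exact: measurable_tnth.
exact: (measurable_fun_pair m1 (@measurable_behead _ T k)).
Qed.

Lemma cons_pairK k : cancel (@cons_pair k) (@uncons k).
Proof. by case=> a x; congr pair; exact: val_inj. Qed.

Lemma unconsK k : cancel (@uncons k) (@cons_pair k).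
Proof. by move=> x; rewrite [RHS]tuple_eta; apply: val_inj. Qed.

Lemma sigma_finite_product d1 d2 (T1 : measurableType d1)
    (T2 : measurableType d2) (m1 : {sigma_finite_measure set T1 -> \bar R})
    (m2 : {sigma_finite_measure set T2 -> \bar R}) :
  sigma_finite setT (m1 \x m2).
Proof.
exact: isSigmaFinite.sigma_finiteT
  (lebesgue_integral_fubini.measure_function_Measure_isSigmaFinite__to__measure_function_isSigmaFinite m1 m2).
Qed.

Section step.
Variables (k : nat) (mu : {sigma_finite_measure set (k.-tuple T) -> \bar R}).

Definition lebesgue_tuple_step := pushforward (lebesgue_measure \x mu) (@cons_pair k).

Let nu : {measure set (k.+1.-tuple T) -> \bar R} :=
  measure_function_pushforward__canonical__measure_function_Measure
    (lebesgue_measure \x mu) (@measurable_cons_pair k).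

Let nu_sigma_finite : sigma_finite setT nu.
Proof.
have [F FT Foo] : sigma_finite setT (lebesgue_measure \x mu).
  exact: sigma_finite_product.
exists (fun n => @uncons k @^-1` F n).
  by rewrite -preimage_bigcup -FT preimage_setT.
move=> n; have [mF ltF] := Foo n; split.
  by rewrite -[X in measurable X]setTI; exact: measurable_uncons.
rewrite /nu /= /pushforward -comp_preimage.
rewrite (_ : _ \o _ = id)//; apply/funext => x; exact: cons_pairK.
Qed.


HB.instance Definition _ := isMeasure.Build _ _ _ lebesgue_tuple_step
  (measure0 nu) (measure_ge0 nu) (@measure_semi_sigma_additive _ _ _ nu).

HB.instance Definition _ := Measure_isSigmaFinite.Build _ _ _ lebesgue_tuple_step
  nu_sigma_finite.

End step.

Lemma lebesgue_tuple_measure k :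
  exists mu : {sigma_finite_measure set (k.-tuple T) -> \bar R},
    mu = @lebesgue_tuple k :> (set (k.-tuple T) -> \bar R).
Proof.
elim: k => [|k [mu muE]]; first by exists \d_([tuple] : 0.-tuple T).
by exists (lebesgue_tuple_step mu); rewrite /= -muE.
Qed.

Section instances.
Variable k : nat.

Let lebesgue_tuple0 : @lebesgue_tuple k set0 = 0.
Proof. by have [mu <-] := lebesgue_tuple_measure k. Qed.

Let lebesgue_tuple_ge0 A : 0 <= @lebesgue_tuple k A.
Proof. by have [mu <-] := lebesgue_tuple_measure k. Qed.

Let lebesgue_tuple_sigma_additive : semi_sigma_additive (@lebesgue_tuple k).
Proof.
have [mu <-] := lebesgue_tuple_measure k.
exact: measure_semi_sigma_additive.
Qed.

HB.instance Definition _ := isMeasure.Build _ _ _ (@lebesgue_tuple k)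
  lebesgue_tuple0 lebesgue_tuple_ge0 lebesgue_tuple_sigma_additive.

Let lebesgue_tuple_sigma_finite : sigma_finite setT (@lebesgue_tuple k).
Proof. by have [mu <-] := lebesgue_tuple_measure k; exact: sigma_finiteT. Qed.

HB.instance Definition _ := Measure_isSigmaFinite.Build _ _ _
  (@lebesgue_tuple k) lebesgue_tuple_sigma_finite.

End instances.

Lemma lebesgue_tuple_box k (A : 'I_k -> set T) :
  (forall i, measurable (A i)) ->
  lebesgue_tuple [set x : k.-tuple T | forall i, A i (tnth x i)] =
  \prod_(i < k) lebesgue_measure (A i).
Proof.
elim: k A => [|k IH] A mA.
  rewrite big_ord0 /= diracE mem_set//=; by case.
rewrite big_ord_recl -IH//= /pushforward.
rewrite -(product_measure1E lebesgue_measure (@lebesgue_tuple k)) //; last first.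
  rewrite (_ : [set _ | _] = \bigcap_(i in [set: 'I_k]) ((@tnth k T ^~ i) @^-1` A (lift ord0 i))).
    apply: fin_bigcap_measurable => // i _.
    rewrite -[X in measurable X]setTI; exact: measurable_tnth.
  by apply/seteqP; split => [x /= h i _|x /= h i]; exact: h.
congr (product_measure1 _ _ _); apply/seteqP; split => -[a x] /= h.
  split; first by have := h ord0.
  by move=> i; have := h (lift ord0 i); rewrite tnthS.
by case: h => ha hx i; case: (unliftP ord0 i) => [j ->|->] //; rewrite tnthS.
Qed.

End lebesgue_tuple.

(* Main.v *)
Require Import Defs.
From mathcomp Require Import all_boot all_order all_algebra.
From mathcomp Require Import all_classical all_reals all_analysis.
From mathcomp Require Import measurable_realfun zify ring lra.

(* Fix a cube [-L, L]^k.  For integer vectors a and b with b <> 0, the set of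
   beta in the cube for which a.alpha + b.beta lies within e of an integer has
   measure O(e), uniformly in a and b.  Summing over the O(M^(r+k)) pairs (a, b)
   of height at most M = M_(nu+1), with e = zeta_nu, bounds the measure of the
   set of beta for which some point with b <> 0 could compete with m_nu^* before
   m_(nu+1)^* appears.  These measures are summable, so by Borel-Cantelli almost
   every beta avoids all but finitely many of these sets.  For such a beta the
   form has trivial integer kernel, since zeta_nu >= 0 and the heights M_nu are
   unbounded, and the best approximations of large height are exactly the points
   m_nu^*. *)

Set Implicit Arguments.
Unset Strict Implicit.

Import Order.TTheory GRing.Theory Num.Theory.
Import numFieldNormedType.Exports.

Local Open Scope classical_set_scope.
Local Open Scope ring_scope.

(** * Distance to the nearest integer *)

Section dist_int.
Variable R : realType.
Implicit Type x : R.

Lemma dist_int_le x (z : int) : dist_int x <= `|x - z%:~R|.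
Proof.
apply: ge_inf; last by exists z.
by exists 0 => _ [y _ <-].
Qed.

Lemma dist_int_le_norm x : dist_int x <= `|x|.
Proof. by have := dist_int_le x 0; rewrite subr0. Qed.

(** Of the floor of [x] and its successor, the one closer to [x] beats every other integer. *)
Lemma dist_int_attained x : exists z : int, dist_int x = `|x - z%:~R|.
Proof.
have /andP[f1 f2] := Num.Theory.floor_itv x.
have key : exists z : int, forall y : int, `|x - z%:~R| <= `|x - y%:~R|.
  have [h|h] := leP (x - (Num.floor x)%:~R) ((Num.floor x + 1)%:~R - x).
    exists (Num.floor x) => y; rewrite ger0_norm ?subr_ge0 ?Num.Theory.floor_le//.
    have [yx|yx] := leP y (Num.floor x).
      have : y%:~R <= (Num.floor x)%:~R :> R by rewrite ler_int.
      by move=> ?; rewrite ger0_norm; lra.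
    have : (Num.floor x + 1)%:~R <= y%:~R :> R by rewrite ler_int lezD1.
    by move=> ?; rewrite ler0_norm; lra.
  exists (Num.floor x + 1) => y; rewrite ler0_norm; last by rewrite subr_le0 ltW.
  have [yx|yx] := leP y (Num.floor x).
    have : y%:~R <= (Num.floor x)%:~R :> R by rewrite ler_int.
    by move=> ?; rewrite ger0_norm; lra.
  have : (Num.floor x + 1)%:~R <= y%:~R :> R by rewrite ler_int lezD1.
  by move=> ?; rewrite ler0_norm; lra.
have [z hz] := key; exists z; apply/eqP; rewrite eq_le dist_int_le/=.
apply: lb_le_inf; first by exists `|x - z%:~R|; exists z.
by move=> _ [y _ <-]; exact: hz.
Qed.

Lemma dist_int_ge0 x : 0 <= dist_int x.
Proof. by have [z ->] := dist_int_attained x. Qed.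

Lemma dist_intDz x (z : int) : dist_int (x + z%:~R) = dist_int x.
Proof.
congr inf; apply/seteqP; split => _ [y _ <-].
  by exists (y - z) => //; congr `|_|; rewrite intrB; lra.
by exists (y + z) => //; congr `|_|; rewrite intrD; lra.
Qed.

Lemma dist_int_le1 x : dist_int x <= 1.
Proof.
have /andP[f1 f2] := Num.Theory.floor_itv x.
apply: (le_trans (dist_int_le x (Num.floor x))).
by rewrite intrD in f2; rewrite ger0_norm; lra.
Qed.

End dist_int.

(** * Heights, values of the linear form, and existence of best approximations *)

Section linear_form.
Context {s : nat}.
Implicit Types m n : s.+1.-tuple int.

Lemma height_leP n H :
  reflect (forall j, (`|tnth n (lift ord0 j)| <= H)%N) (height n <= H)%N.
Proof. by apply: (iffP (bigmax_leqP _ _ _)) => h j //; exact: h. Qed.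

Lemma height_gt0P n :
  reflect (exists j, tnth n (lift ord0 j) != 0) (0 < height n)%N.
Proof.
rewrite ltnNge; apply: (iffP idP) => [/height_leP h|[j nj]].
  apply: contrapT => /forallNP nh; apply: h => j.
  by have /negP := nh j; rewrite negbK => /eqP ->.
by apply/height_leP => /(_ j); rewrite leqn0 absz_eq0 (negPf nj).
Qed.

Lemma height_tail m n :
  (forall j, tnth m (lift ord0 j) = tnth n (lift ord0 j)) -> height m = height n.
Proof. by move=> h; apply: eq_bigr => j _; rewrite h. Qed.

(** Since [dist_int (zeta g n)] ignores the entry n_0, this encoding reduces questions about all
    points of bounded height to a finite type. It serves both to find minima and to count points. *)
Lemma height_le_ffun n H : (height n <= H)%N ->
  exists f : {ffun 'I_s -> 'I_(2 * H).+1},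
    forall j, tnth n (lift ord0 j) = (f j)%:Z - H%:Z.
Proof.
move=> /height_leP h.
exists [ffun j => inord (absz (tnth n (lift ord0 j) + H%:Z))] => j.
by rewrite ffunE inordK; have := h j; lia.
Qed.

Variable R : realType.
Variable g : s.-tuple R.

Lemma dist_int_zeta_tail m n :
  (forall j, tnth m (lift ord0 j) = tnth n (lift ord0 j)) ->
  dist_int (zeta g m) = dist_int (zeta g n).
Proof.
move=> h; rewrite -(dist_intDz (zeta g m) (tnth n ord0 - tnth m ord0)); congr dist_int.
rewrite /zeta (eq_bigr _ (fun j _ => congr1 (fun z : int => z%:~R * _) (h j))).
by rewrite intrB; lra.
Qed.

Lemma zeta_nearest n :
  exists2 n', height n' = height n & zeta g n' = dist_int (zeta g n).
Proof.
have [z ->] := dist_int_attained (zeta g n).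
(* Subtracting [z] from n_0 and choosing the sign of the whole point makes the value of the form
   equal to the distance; neither change affects the height. *)
pose e : int := if 0 <= zeta g n - z%:~R then 1 else -1.
exists [tuple e * (tnth n j - (if j == ord0 then z else 0)) | j < s.+1].
  apply: eq_bigr => j _; rewrite tnth_mktuple/= subr0 /e.
  by case: ifP => _; rewrite ?mul1r ?mulN1r ?abszN.
rewrite /zeta tnth_mktuple/= (eq_bigr (fun j =>
    e%:~R * ((tnth n (lift ord0 j))%:~R * tnth g j))); last first.
  by move=> j _; rewrite tnth_mktuple/= subr0 intrM mulrA.
rewrite -mulr_sumr intrM intrB -mulrDr addrAC -/(zeta g n) /e.
case: ifPn => [h|]; first by rewrite mul1r ger0_norm.
by rewrite -ltNge => h; rewrite mulN1r ltr0_norm.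
Qed.

Lemma zeta_inj :
  (forall n, zeta g n = 0 -> forall j, tnth n j = 0) -> injective (zeta g).
Proof.
move=> h m n mn; apply: eq_from_tnth => j; apply/eqP; rewrite -subr_eq0.
have := h [tuple tnth m i - tnth n i | i < s.+1] _ j.
rewrite tnth_mktuple => ->//; rewrite /zeta tnth_mktuple.
rewrite (eq_bigr (fun i => (tnth m (lift ord0 i))%:~R * tnth g i
    - (tnth n (lift ord0 i))%:~R * tnth g i)); last first.
  by move=> i _; rewrite tnth_mktuple intrB mulrBl.
by rewrite sumrB intrB; move: mn; rewrite /zeta => mn; lra.
Qed.

Lemma lin_indep_zeta_eq0 n : lin_indep_Q g -> zeta g n = 0 ->
  forall j, tnth n j = 0.
Proof.
move=> gi n0 j; pose q := [tuple (tnth n i)%:~R : rat | i < s.+1].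
suff : tnth q j = 0 by rewrite tnth_mktuple => /eqP; rewrite intr_eq0 => /eqP.
apply: gi; rewrite tnth_mktuple ratr_int -[RHS]n0; congr (_ + _).
by apply: eq_bigr => i _; rewrite tnth_mktuple ratr_int.
Qed.

(** Attainment of the minimum amounts to a sign condition: [m] is itself admissible, and a
    nonnegative [zeta g m] is its own absolute value, hence at least its distance to the
    integers. *)
Lemma best_approxP m : best_approx g m <->
  [/\ (0 < height m)%N, 0 <= zeta g m &
      forall n, (0 < height n <= height m)%N ->
        zeta g m <= dist_int (zeta g n)].
Proof.
split=> [[_ [n /andP[n0 nm] mn] h]|[m0 zm h]].
  by split => //; [exact: leq_trans nm|rewrite mn dist_int_ge0].
split=> //.
  by have /height_gt0P[j /eqP mj] := m0; exists (lift ord0 j).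
exists m; first by rewrite m0 leqnn.
apply/eqP; rewrite eq_le h ?m0 ?leqnn//=.
by rewrite -[leRHS]ger0_norm// dist_int_le_norm.
Qed.

Lemma best_approx_zeta_le m n : best_approx g m -> best_approx g n ->
  (height n <= height m)%N -> zeta g m <= zeta g n.
Proof.
move=> /best_approxP[_ _ h] /best_approxP[n0 zn _] nm.
rewrite -[leRHS]ger0_norm//; apply: le_trans (dist_int_le_norm _).
by apply: h; rewrite n0.
Qed.

(** Each of the two points competes with the other, so their values of the form agree. *)
Lemma best_approx_height_inj m n : injective (zeta g) ->
  best_approx g m -> best_approx g n -> height m = height n -> m = n.
Proof.
move=> gi bm bn mn; apply: gi; apply/eqP.
by rewrite eq_le !best_approx_zeta_le// mn.
Qed.

Lemma best_approx_exists H : (0 < s)%N -> (0 < H)%N ->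
  exists2 m, best_approx g m & (height m <= H)%N /\
    forall n, (0 < height n <= H)%N -> zeta g m <= dist_int (zeta g n).
Proof.
move=> s0 H0.
pose pt (f : {ffun 'I_s -> 'I_(2 * H).+1}) : s.+1.-tuple int :=
  [tuple of 0 :: [tuple (f j)%:Z - H%:Z | j < s]].
have ptE f j : tnth (pt f) (lift ord0 j) = (f j)%:Z - H%:Z.
  by rewrite tnthS tnth_mktuple.
pose P f := (0 < height (pt f))%N.
(* [ord_max] encodes the coefficient [2 * H - H = H], which is nonzero, so the set to minimise over
   is inhabited. *)
have P0 : P [ffun=> ord_max].
  apply/height_gt0P; exists (Ordinal s0).
  by rewrite ptE ffunE subr_eq0 eqz_nat mulSn mul1n -[X in _ != X]addn0 eqn_add2l -lt0n.
have [f Pf fmin] := @arg_minP _ R _ _ P (fun f => dist_int (zeta g (pt f))) P0.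
have [m mf zm] := zeta_nearest (pt f).
have mH : (height m <= H)%N.
  rewrite mf; apply/height_leP => j; rewrite ptE.
  by move: (f j) (ltn_ord (f j)) => i; clear; lia.
have mmin n : (0 < height n <= H)%N -> zeta g m <= dist_int (zeta g n).
  move=> /andP[n0 /height_le_ffun[f' hf']].
  have tl j : tnth n (lift ord0 j) = tnth (pt f') (lift ord0 j).
    by rewrite ptE hf'.
  rewrite zm (dist_int_zeta_tail tl); apply: fmin.
  by rewrite /P -(height_tail tl).
exists m => //; apply/best_approxP; split.
- by rewrite mf.
- by rewrite zm dist_int_ge0.
- by move=> n /andP[n0 nm]; apply: mmin; rewrite n0 (leq_trans nm).
Qed.

End linear_form.

(** * Strictly increasing sequences of naturals and enumeration by height *)

Lemma increasing_geq_id (u : nat -> nat) : (forall i, (u i < u i.+1)%N) ->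
  forall i, (i <= u i)%N.
Proof. by move=> uS; elim=> // i IH; apply: leq_ltn_trans (uS i). Qed.

Lemma increasing_homo (u : nat -> nat) : (forall i, (u i < u i.+1)%N) ->
  {homo u : i j / (i <= j)%N}.
Proof.
by move=> uS; apply: homo_leq => // [j i l|i]; [exact: leq_trans|exact: ltnW].
Qed.

Lemma increasing_locate (u : nat -> nat) N H :
  (forall i, (u i < u i.+1)%N) -> (u N <= H)%N ->
  exists2 i, (N <= i)%N & (u i <= H < u i.+1)%N.
Proof.
move=> uS uNH; have um := increasing_homo uS.
have exP : exists i, (H < u i)%N by exists H.+1; exact: increasing_geq_id.
case: (ex_minnP exP) => -[|i] Hi imin.
  by have := um 0%N N (leq0n _); rewrite leqNgt (leq_ltn_trans uNH).
exists i.
  rewrite leqNgt; apply/negP => /um.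
  by rewrite leqNgt (leq_ltn_trans uNH).
by rewrite Hi andbT leqNgt; apply/negP => /imin; rewrite ltnn.
Qed.

(** A sequence that already lists everything in [B] from some height on is completed downwards: the
    highest missing element is prepended, which lowers [h (p 0)], so finitely many rounds
    suffice. *)
Lemma increasing_enum (T : Type) (h : T -> nat) (B : set T) (p : nat -> T) :
  (forall x y, B x -> B y -> h x = h y -> x = y) ->
  (forall i, (h (p i) < h (p i.+1))%N) -> (forall i, B (p i)) ->
  (forall x, B x -> (h (p 0%N) <= h x)%N -> range p x) ->
  exists2 q : nat -> T, range q = B & forall i, (h (q i) < h (q i.+1))%N.
Proof.
move=> hinj; have [H] : exists H, (h (p 0%N) <= H)%N by exists (h (p 0%N)).
elim: H p => [|H IH] p pH pS Bp pB.
  exists p => //; apply/seteqP; split=> [_ [i _ <-]//|x Bx].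
  by apply: pB => //; apply: leq_trans pH _.
pose P c := `[< exists2 x, B x & h x = c /\ (c < h (p 0%N))%N >].
have [exP|nP] := pselect (exists c, P c); last first.
  exists p => //; apply/seteqP; split=> [_ [i _ <-]//|x Bx].
  apply: pB => //; rewrite leqNgt; apply/negP => xp; apply: nP.
  by exists (h x); apply/asboolP; exists x.
have Pub c : P c -> (c <= h (p 0%N))%N.
  by move=> /asboolP[x _ [_ /ltnW]].
case: (ex_maxnP exP Pub) => c /asboolP[x Bx [xc cp]] cmax.
apply: (IH (fun i => if i is j.+1 then p j else x)).
- by rewrite xc -ltnS (leq_trans cp).
- by case=> [|i] //=; rewrite xc.
- by case.
- move=> y By; rewrite xc => cy.
  have [py|yp] := leqP (h (p 0%N)) (h y).
    by have [i _ <-] := pB _ By py; exists i.+1.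
  exists 0%N => //; apply: hinj => //; rewrite xc; apply/eqP.
  by rewrite eqn_leq cy cmax//; apply/asboolP; exists y.
Qed.

(** * Passing from [alpha] to the extended tuple when [beta] is not exceptional *)

Section extend.
Variables (R : realType) (r k : nat) (alpha : r.-tuple R) (beta : k.-tuple R).
Implicit Types (a : r.+1.-tuple int) (n : (r + k).+1.-tuple int).

Lemma pad0_ord0 a : tnth (pad0 k a) ord0 = tnth a ord0.
Proof. by case: a => -[]// x s ?; rewrite !(tnth_nth 0). Qed.

Lemma pad0_lshift a i :
  tnth (pad0 k a) (lift ord0 (lshift k i)) = tnth a (lift ord0 i).
Proof. by rewrite !(tnth_nth 0) /= nth_cat size_tuple ltnS ltn_ord. Qed.

Lemma pad0_rshift a i : tnth (pad0 k a) (lift ord0 (rshift r i)) = 0.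
Proof.
rewrite !(tnth_nth 0) /= nth_cat size_tuple /bump /= add1n ltnS.
by rewrite ltnNge leq_addr/= nth_nseq if_same.
Qed.

Lemma height_pad0 a : height (pad0 k a) = height a.
Proof.
rewrite /height big_split_ord/= [X in maxn _ X]big1 ?maxn0.
  by apply: eq_bigr => i _; rewrite pad0_lshift.
by move=> i _; rewrite pad0_rshift.
Qed.

Lemma zeta_cat n : zeta (cat_tuple alpha beta) n =
  (tnth n ord0)%:~R +
  \sum_(i < r) (tnth n (lift ord0 (lshift k i)))%:~R * tnth alpha i +
  \sum_(j < k) (tnth n (lift ord0 (rshift r j)))%:~R * tnth beta j.
Proof.
rewrite /zeta big_split_ord/= addrA; congr (_ + _ + _).
  by apply: eq_bigr => i _; rewrite tnth_lshift.
by apply: eq_bigr => i _; rewrite tnth_rshift.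
Qed.

Lemma zeta_pad0 a : zeta (cat_tuple alpha beta) (pad0 k a) = zeta alpha a.
Proof.
rewrite zeta_cat pad0_ord0 [X in _ + X]big1 ?addr0; last first.
  by move=> j _; rewrite pad0_rshift mul0r.
by congr (_ + _); apply: eq_bigr => i _; rewrite pad0_lshift.
Qed.

Lemma pad0P n : (forall j, tnth n (lift ord0 (rshift r j)) = 0) ->
  exists a, n = pad0 k a.
Proof.
move=> n0.
exists [tuple of tnth n ord0 :: [tuple tnth n (lift ord0 (lshift k i)) | i < r]].
apply: eq_from_tnth => j; case: (unliftP ord0 j) => [i|] ->.
  case: (split_ordP i) => i' ->; last by rewrite n0 pad0_rshift.
  by rewrite pad0_lshift tnthS tnth_mktuple.
by rewrite pad0_ord0 tnth0.
Qed.

Variable m : nat -> r.+1.-tuple int.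
Hypotheses (hr : (0 < r)%N) (halpha : lin_indep_Q alpha)
  (hm : best_approx_seq alpha m).

Lemma best_approx_seq_best i : best_approx alpha (m i).
Proof. by have [h _] := hm; have : range m (m i) by [exists i]; rewrite h. Qed.

(** The minimum over heights up to [height a] is attained at a best approximation, which is some
    term [m i']. Its height is below that of [m i.+1], so [i' <= i], and values of the form do not
    increase along the sequence. *)
Lemma best_approx_seq_min i a :
  (0 < height a < height (m i.+1))%N -> zeta alpha (m i) <= dist_int (zeta alpha a).
Proof.
move=> /andP[a0 am].
have [m' bm' [m'a hm']] := best_approx_exists alpha hr a0.
have [hrange mS] := hm.
have [i' _ m'E] : range m m' by rewrite hrange.
apply: le_trans (hm' a _); last by rewrite a0 leqnn.
apply: best_approx_zeta_le => //; first exact: best_approx_seq_best.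
rewrite -m'E; apply: (increasing_homo mS); rewrite leqNgt; apply/negP.
by move/(increasing_homo mS); rewrite leqNgt m'E (leq_ltn_trans m'a).
Qed.

Local Notation ab := (cat_tuple alpha beta).

(** This is the deterministic half of the argument: from index [N] on, points that involve [beta]
    are too far from the integers to compete, so only padded points remain. *)
Lemma best_approx_seq_extend N :
  (forall i n, (N <= i)%N -> (height n <= height (m i.+1))%N ->
    (exists j, tnth n (lift ord0 (rshift r j)) != 0) ->
    zeta alpha (m i) < dist_int (zeta ab n)) ->
  exists2 m' : nat -> (r + k).+1.-tuple int,
    best_approx_seq ab m' &
    finite_set (range m' `+` range (fun i => pad0 k (m i))).
Proof.
move=> far; have [hrange mS] := hm.
have m_ge0 i : 0 <= zeta alpha (m i).
  by have /best_approxP[] := best_approx_seq_best i.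
have tailP n : (exists j, tnth n (lift ord0 (rshift r j)) != 0) \/
    exists a, n = pad0 k a.
  have [h|h] := pselect (exists j, tnth n (lift ord0 (rshift r j)) != 0).
    by left.
  right; apply: pad0P => j; apply/eqP/negPn/negP => nj; apply: h.
  by exists j.
have abI : injective (zeta ab).
  apply: zeta_inj => n n0.
  have [tl|[a na]] := tailP n.
    (* Indices never exceed the heights of their terms, so this index is large enough for [far] to
       apply to [n]; with [zeta ab n = 0] it would force a negative [zeta alpha (m i)]. *)
    have := @far (maxn N (height n)) n (leq_maxl _ _) _ tl.
    rewrite (leq_trans (leq_maxr N (height n))); last first.
      by apply: leq_trans (increasing_geq_id mS _); exact: leqnSn.
    rewrite n0 => /(_ isT) /lt_le_trans/(_ (dist_int_le_norm _)).
    by rewrite normr0 ltNge m_ge0.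
  move: n0; rewrite na zeta_pad0 => /(lin_indep_zeta_eq0 halpha) a0 j.
  case: (unliftP ord0 j) => [i|] ->; last by rewrite pad0_ord0.
  by case: (split_ordP i) => i' ->; rewrite ?pad0_lshift ?pad0_rshift.
(* The height bound is strict because among padded points [m i.+1] may do better than [m i]. *)
have lower i n : (N <= i)%N -> (0 < height n < height (m i.+1))%N ->
    zeta alpha (m i) <= dist_int (zeta ab n).
  move=> Ni /andP[n0 ni]; have [tl|[a na]] := tailP n.
    by apply/ltW/far => //; exact: ltnW.
  rewrite na zeta_pad0; apply: best_approx_seq_min.
  by rewrite -height_pad0 -na n0.
have best i : (N <= i)%N -> best_approx ab (pad0 k (m i)).
  have /best_approxP[mi0 _ _] := best_approx_seq_best i.
  move=> Ni; apply/best_approxP; rewrite height_pad0 zeta_pad0; split => //.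
  by move=> n /andP[n0 ni]; apply: lower => //; rewrite n0 (leq_ltn_trans ni).
have cover n : best_approx ab n -> (height (m N) <= height n)%N ->
    exists2 i, (N <= i)%N & n = pad0 k (m i).
  (* The height of [n] lies in the window of [m i]: [n] does at least as well because [m i] is no
     higher, and no better by [lower]; injectivity of the form then identifies them. *)
  move=> bn /(increasing_locate mS)[i Ni /andP[in1 in2]]; exists i => //.
  have /best_approxP[n0 zn nmin] := bn.
  apply: abI; apply/eqP; rewrite eq_le; apply/andP; split.
    by apply: best_approx_zeta_le (best _ Ni) _ => //; rewrite height_pad0.
  rewrite zeta_pad0 -[leRHS]ger0_norm//.
  by apply: le_trans (dist_int_le_norm _); apply: lower => //; rewrite n0.
have [m' m'E m'S] : exists2 m' : nat -> (r + k).+1.-tuple int,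
    range m' = [set n | best_approx ab n] &
    forall i, (height (m' i) < height (m' i.+1))%N.
  apply: (@increasing_enum _ (@height (r + k)) (best_approx ab) (fun i => pad0 k (m (N + i)%N))).
  - by move=> x y; exact: best_approx_height_inj.
  - by move=> i; rewrite !height_pad0 addnS.
  - by move=> i; apply: best; exact: leq_addr.
  - move=> n bn; rewrite height_pad0 addn0 => /(cover _ bn)[i Ni ->].
    by exists (i - N)%N => //; rewrite subnKC.
exists m' => //; rewrite setY_def.
(* A term of [m'] outside the padded sequence has height below [height (m N)], hence index below it;
   a padded term outside [m'] has index below [N]. *)
apply: (@sub_finite_set _ _ (m' @` `I_(height (m N)) `|`
    (fun i => pad0 k (m i)) @` `I_N)).
  move=> n [[nm' nm]|[[i _ <-] nm']].
    left; have bn : best_approx ab n by move: nm'; rewrite m'E.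
    have [i _ iE] := nm'; exists i => //=.
    apply: (leq_ltn_trans (increasing_geq_id m'S i)); rewrite iE ltnNge.
    by apply/negP => /(cover _ bn)[j _ nj]; apply: nm; exists j.
  right; exists i => //=; rewrite ltnNge; apply/negP => Ni.
  by apply: nm'; rewrite m'E; exact: best.
by rewrite finite_setU; split; exact/finite_image/finite_II.
Qed.

End extend.

(** * Union bound and a Tonelli bound for product measures *)

Lemma measure_bigsetU_le (d : measure_display) (T : measurableType d)
    (R : realType) (mu : {measure set T -> \bar R}) (I : Type) (s : seq I)
    (P : pred I) (F : I -> set T) (c : R) : 0 <= c ->
  (forall i, measurable (F i)) -> (forall i, P i -> (mu (F i) <= c%:E)%E) ->
  (mu (\big[setU/set0]_(i <- s | P i) F i) <= ((size s)%:R * c)%:E)%E.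
Proof.
move=> c0 mF muF; elim: s => [|i s IH].
  by rewrite big_nil measure0 mul0r.
rewrite big_cons /= -natr1 mulrDl mul1r addrC EFinD; case: ifPn => Pi.
  apply: (le_trans (measureU2 _ _ _)) => //.
    by apply: bigsetU_measurable => j _.
  by apply: leeD => //; exact: muF.
by apply: (le_trans IH); rewrite leeDr// lee_fin.
Qed.

(** The measure of [A] is the integral of its section measures, which are dominated by [c] times the
    indicator of [D]. *)
Lemma product_measure1_le (d1 d2 : measure_display) (T1 : measurableType d1)
    (T2 : measurableType d2) (R : realType) (m1 : {measure set T1 -> \bar R})
    (m2 : {sigma_finite_measure set T2 -> \bar R}) (A : set (T1 * T2))
    (D : set T1) (c : R) : 0 <= c -> measurable A -> measurable D ->
  (forall x, D x -> (m2 (xsection A x) <= c%:E)%E) ->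
  (forall x, ~ D x -> xsection A x = set0) ->
  ((m1 \x m2)%E A <= c%:E * m1 D)%E.
Proof.
move=> c0 mA mD AD AnD.
have mDT := integral_indic m1 measurableT mD; rewrite setIT in mDT.
rewrite /product_measure1 -mDT.
rewrite -ge0_integralZl_EFin//; last by apply/measurable_EFinP.
apply: ge0_le_integral => //.
- exact: measurable_fun_xsection.
- by apply: emeasurable_funM => //; apply/measurable_EFinP.
- move=> x _ /=; rewrite indicE; have [Dx|nDx] := pselect (D x).
    by rewrite mem_set// mule1 AD.
  by rewrite memNset// mule0 AnD// measure0.
Qed.

(** * Measure of the points of a cube where an affine form is near an integer *)

Section near_integer.
Variable R : realType.
Local Notation T := (measurableTypeR R).
Local Notation leb := (@lebesgue_measure R).
Variable L : nat.

Lemma lebesgue_measure_cc (u v : R) : u <= v ->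
  leb (`[u, v] : set T) = (v - u)%:E.
Proof.
move=> uv; rewrite lebesgue_measure_itv/= lte_fin.
have [|vu] := ltP u v; first by rewrite EFinB.
by have -> : u = v by [apply/eqP; rewrite eq_le uv]; rewrite subrr.
Qed.

Definition near_int1 (c b e : R) : set T :=
  [set x | `|x| <= L%:R /\ exists z : int, `|c + b * x - z%:~R| <= e].

(** The constant [c] stands for the contribution of [alpha], and the integer [z] absorbs n_0. The
    cube keeps the measure finite. *)
Definition near_int (k : nat) (b : 'I_k -> int) (c e : R) : set (k.-tuple T) :=
  [set x | (forall i, `|tnth x i| <= L%:R) /\
    exists z : int, `|c + \sum_(i < k) (b i)%:~R * tnth x i - z%:~R| <= e].

Lemma measurable_norm_le (d : measure_display) (X : measurableType d)
    (f : X -> R) (e : R) : measurable_fun setT f ->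
  measurable [set x | `|f x| <= e].
Proof.
move=> mf; rewrite -[X in measurable X]setTI.
by apply: measurable_fun_le => //; exact: measurableT_comp.
Qed.

Lemma measurable_near_int1 c b e : measurable (near_int1 c b e).
Proof.
apply: measurableI; first by apply: measurable_norm_le; exact: measurable_id.
rewrite [X in measurable X](_ : _ = \bigcup_(z in [set: int])
    [set x : T | `|c + b * x - z%:~R| <= e]); last first.
  by apply/seteqP; split=> [x [z hz]|x [z _ hz]]; exists z.
apply: countable_bigcupT_measurable => // z; apply: measurable_norm_le.
apply: measurable_funB => //; exact: measurable_funD.
Qed.

Lemma measurable_near_int k (b : 'I_k -> int) c e :
  measurable (near_int b c e).
Proof.
apply: measurableI.
  rewrite [X in measurable X](_ : _ = \bigcap_(i in [set: 'I_k])
      [set x : k.-tuple T | `|tnth x i| <= L%:R]); last first.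
    by apply/seteqP; split=> [x h i _|x h i]; exact: h.
  apply: fin_bigcap_measurable => // i _; apply: measurable_norm_le.
  exact: measurable_tnth.
rewrite [X in measurable X](_ : _ = \bigcup_(z in [set: int]) [set x : k.-tuple T |
    `|c + \sum_(i < k) (b i)%:~R * tnth x i - z%:~R| <= e]); last first.
  by apply/seteqP; split=> [x [z hz]|x [z _ hz]]; exists z.
apply: countable_bigcupT_measurable => // z; apply: measurable_norm_le.
apply: measurable_funB => //; apply: measurable_funD => //.
apply: measurable_sum => i; apply: measurable_funM => //.
exact: measurable_tnth.
Qed.

(** The set is covered by intervals of length [2 * e / |b|] centred at the points [(z - c) / b]. The
    number of relevant integers [z] is at most [(2 * L + 5) * |b|], so [|b|] cancels and the bound
    is uniform in [b] and [c]. *)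
Lemma near_int1_measure (b : int) (c e : R) : b != 0 -> 0 <= e <= 1 ->
  (leb (near_int1 c b%:~R e) <= ((2 * L + 5)%:R * (2 * e))%:E)%E.
Proof.
move=> b0 /andP[e0 e1].
(* A relevant [z] differs from the floor of [c] by at most [|b| * L] from the term [b * x], plus
   [e <= 1], plus 1 for the fractional part of [c]. *)
pose N := (absz b * L + 2)%N; pose F := Num.floor c.
pose p (i : 'I_(2 * N).+1) : R := ((F + i%:Z - N%:Z)%:~R - c) / b%:~R.
have B0 : (0 : R) < (absz b)%:R by rewrite ltr0n absz_gt0.
have BE : `|b%:~R : R| = (absz b)%:R by rewrite -intr_norm -abszE.
have b0' : (b%:~R : R) != 0 by rewrite intr_eq0.
pose w : R := e / (absz b)%:R.
have w0 : 0 <= w by rewrite divr_ge0// ltW.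
have /andP[F1 F2] := Num.Theory.floor_itv c.
pose I i : set T := `[p i - w, p i + w]%classic.
have mI i : measurable (I i) by exact: measurable_itv.
have cover : near_int1 c b%:~R e `<=`
    \big[setU/set0]_(i <- enum 'I_(2 * N).+1) I i.
  move=> x [xL [z hz]].
  have zF : `|(z - F)%:~R| <= N%:R :> R.
    have bx : `|b%:~R * x| <= (absz b * L)%:R.
      by rewrite normrM BE natrM ler_wpM2l// ltW.
    move: hz bx F1 F2; rewrite intrD intrB /N natrD !ler_norml => hz bx F1 F2.
    by lra.
  have zN : (absz (z - F) <= N)%N.
    by rewrite -(ler_nat R) natr_absz intr_norm.
  have iN : (absz (z - F + N%:Z)%R < (2 * N).+1)%N by move: zN; clear; lia.
  rewrite -bigcup_seq; exists (Ordinal iN); first by rewrite /= mem_enum.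
  have zE : F + (absz (z - F + N%:Z))%:Z - N%:Z = z by move: zN; clear; lia.
  rewrite /I /= in_itv/= /p/= zE -ler_distl /w.
  rewrite ler_pdivlMr// -BE -normrM mulrBl mulfVK//.
  by rewrite (_ : _ - _ = c + b%:~R * x - z%:~R)//; lra.
apply: (le_trans (le_measure _ _ _ cover)).
- by rewrite inE; exact: measurable_near_int1.
- by rewrite inE; apply: bigsetU_measurable.
apply: (le_trans (@measure_bigsetU_le _ T R lebesgue_measure _ (enum 'I_(2 * N).+1) xpredT I (2 * w) _ _ _)).
- by rewrite mulr_ge0.
- exact: mI.
- move=> i _; rewrite [leLHS]lebesgue_measure_cc; last by lra.
  by rewrite lee_fin; lra.
rewrite lee_fin size_enum_ord /w /N.
have B1 : (1 : R) <= (absz b)%:R by rewrite ler1n absz_gt0.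
have -> : 2 * (e / (absz b)%:R) = (2 * e) / (absz b)%:R by rewrite mulrA.
rewrite mulrA ler_pdivrMr// mulrAC ler_wpM2r//; first by lra.
rewrite -natrM ler_nat; have : (0 < absz b)%N by rewrite absz_gt0.
by nia.
Qed.

(** Induction on [k]. If some coefficient after the first is nonzero, the slices at a fixed first
    coordinate obey the inductive bound, whatever the constant; otherwise only the first coordinate
    is constrained and the set lies in a box. *)
Lemma near_int_measure k (b : 'I_k -> int) (c e : R) :
  (exists i, b i != 0) -> 0 <= e <= 1 ->
  (lebesgue_tuple (near_int b c e) <= ((2 * L + 5)%:R ^+ k * (2 * e))%:E)%E.
Proof.
move=> + /andP[e0 e1]; elim: k b c => [|k IH] b c [i bi]; first by case: i bi.
have LL : (- L%:R : R) <= L%:R by have : (0 : R) <= L%:R by []; lra.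
have L5 : (L%:R - - L%:R : R) <= (2 * L + 5)%:R.
  by rewrite natrD natrM; lra.
pose b' j := b (lift ord0 j).
have mA := @measurable_near_int k.+1 b c e.
have [tl|tl] := pselect (exists j, b' j != 0).
  have [mu muE] := lebesgue_tuple_measure R k.
  rewrite /= /pushforward.
  have -> : (lebesgue_measure \x @lebesgue_tuple R k)%E =
      (lebesgue_measure \x mu)%E by rewrite muE.
  pose C : R := (2 * L + 5)%:R ^+ k * (2 * e).
  have C0 : 0 <= C by rewrite mulr_ge0 ?exprn_ge0// mulr_ge0.
  pose D : set T := `[- L%:R, L%:R]%classic.
  apply: (le_trans (@product_measure1_le _ _ _ _ _ _ _ _ D C C0 _ _ _ _)) => //.
  - rewrite -[X in measurable X]setTI; exact: measurable_cons_pair.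
  - exact: measurable_itv.
  - move=> x _; apply: (@le_trans _ _ (mu (near_int b' (c + (b ord0)%:~R * x) e))).
        apply: le_measure; rewrite ?inE.
        + apply: measurable_xsection.
          by rewrite -[X in measurable X]setTI; exact: measurable_cons_pair.
        + exact: measurable_near_int.
        + move=> y /xsectionP[/= yL [z hz]]; split.
            by move=> j; have := yL (lift ord0 j); rewrite tnthS.
          exists z; move: hz; rewrite big_ord_recl tnth0 addrA.
          by under eq_bigr do rewrite tnthS.
      by rewrite muE; exact: IH.
  - move=> x xL; rewrite -subset0 => y /xsectionP[/= yL _]; apply: xL.
    by have := yL ord0; rewrite tnth0 ler_norml /D/= in_itv.
  rewrite [X in (_ * X)%E](lebesgue_measure_cc LL) -EFinM lee_fin /C exprS -mulrA mulrC.
  by rewrite ler_wpM2r.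
have b0 j : b (lift ord0 j) = 0.
  by apply/eqP/negPn/negP => bj; apply: tl; exists j.
have b00 : b ord0 != 0.
  by case: (unliftP ord0 i) bi => [j|] -> //; rewrite b0 eqxx.
(* The form now depends on the first coordinate alone; the others contribute sides of length
   [2 * L]. *)
pose A (j : 'I_k.+1) : set T := if j == ord0 then near_int1 c (b ord0)%:~R e
  else `[- L%:R, L%:R]%classic.
have mAj j : measurable (A j).
  by rewrite /A; case: ifP => _; [exact: measurable_near_int1|exact: measurable_itv].
apply: (@le_trans _ _ (lebesgue_tuple [set x : k.+1.-tuple T |
    forall j, A j (tnth x j)])).
  apply: le_measure; rewrite ?inE//.
    rewrite [X in measurable X](_ : _ = \bigcap_(j in [set: 'I_k.+1])
        ((@tnth k.+1 T ^~ j) @^-1` A j)); last first.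
      by apply/seteqP; split=> [x h j _|x h j]; exact: h.
    apply: fin_bigcap_measurable => // j _.
    by rewrite -[X in measurable X]setTI; exact: measurable_tnth.
  move=> x [xL [z hz]] j; rewrite /A; case: eqP => [->|_]; last first.
    by rewrite /= in_itv/= -ler_norml.
  split=> //; exists z; move: hz; rewrite big_ord_recl big1 ?addr0// => l _.
  by rewrite b0 mul0r.
rewrite lebesgue_tuple_box// big_ord_recl /A eqxx.
rewrite (eq_bigr (fun=> (L%:R - - L%:R)%:E)); last first.
  by move=> j _; rewrite -lebesgue_measure_cc.
rewrite prodEFin prodr_const card_ord exprSr -mulrA EFinM muleC.
apply: lee_pmul => //.
- by rewrite lee_fin lerXn2r// nnegrE; lra.
- by apply: near_int1_measure; rewrite ?e0.
Qed.

End near_integer.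

(** * Exceptional sets and the Borel-Cantelli argument *)

Lemma nneseries_EFin_lty (R : realType) (u : R^nat) : (forall n, 0 <= u n) ->
  cvgn (series u) -> (\sum_(n <oo) (u n)%:E < +oo)%E.
Proof.
move=> u0 cu.
rewrite (_ : (\sum_(n <oo) (u n)%:E)%E = (limn (series u))%:E) ?ltry//.
by rewrite -EFin_lim//; congr (limn _); apply/funext => n /=; rewrite sumEFin.
Qed.

Section exceptional.
Variables (R : realType) (r k : nat) (alpha : r.-tuple R).
Local Notation T := (measurableTypeR R).

(* The function [f] encodes the coefficients [f j - M], which range over
   [-M..M]. *)
Definition exceptional (L M : nat) (e : R) : set (k.-tuple T) :=
  \big[setU/set0]_(f <- enum {ffun 'I_(r + k) -> 'I_(2 * M).+1}
      | [exists j, (f (rshift r j))%:Z - M%:Z != 0])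
    near_int L (fun j => (f (rshift r j))%:Z - M%:Z)
      (\sum_(i < r) ((f (lshift k i))%:Z - M%:Z)%:~R * tnth alpha i) e.

Lemma measurable_exceptional L M e : measurable (exceptional L M e).
Proof. by apply: bigsetU_measurable => f _; exact: measurable_near_int. Qed.

(** Union bound over all [(2 * M + 1) ^ (r + k)] coefficient vectors, including those that the
    filter discards. *)
Lemma exceptional_measure L M e : 0 <= e <= 1 ->
  (lebesgue_tuple (exceptional L M e) <=
   ((2 * M).+1%:R ^+ (r + k) * ((2 * L + 5)%:R ^+ k * (2 * e)))%:E)%E.
Proof.
move=> e01; apply: (le_trans (@measure_bigsetU_le _ _ _ (@lebesgue_tuple R k)
  _ _ _ _ ((2 * L + 5)%:R ^+ k * (2 * e)) _ _ _)).
- by have /andP[e0 _] := e01; rewrite mulr_ge0 ?exprn_ge0 ?mulr_ge0.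
- by move=> f; exact: measurable_near_int.
- by move=> f /existsP ?; exact: near_int_measure.
- by rewrite -cardE card_ffun !card_ord natrX.
Qed.

Lemma notin_exceptional L M e (beta : k.-tuple T) (n : (r + k).+1.-tuple int) :
  (forall j, `|tnth beta j| <= L%:R) -> (height n <= M)%N ->
  (exists j, tnth n (lift ord0 (rshift r j)) != 0) ->
  ~ exceptional L M e beta -> e < dist_int (zeta (cat_tuple alpha beta) n).
Proof.
move=> bL /height_le_ffun[f nf] [j nj]; apply: contra_notT; rewrite -leNgt => ze.
rewrite /exceptional -bigcup_seq_cond; exists f => /=.
  by rewrite mem_enum; apply/existsP; exists j; rewrite -nf.
split => //; have [z dz] := dist_int_attained (zeta (cat_tuple alpha beta) n).
(* The form in [near_int] has no n_0, so the nearest integer is shifted by it. *)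
exists (z - tnth n ord0); move: ze; rewrite dz zeta_cat.
rewrite (eq_bigr (fun i => ((f (lshift k i))%:Z - M%:Z)%:~R * tnth alpha i));
  last by move=> i _; rewrite nf.
rewrite (eq_bigr (fun l =>
  ((f (rshift r l))%:Z - M%:Z)%:~R * tnth beta l));
  last by move=> l _; rewrite nf.
by congr (`|_| <= _); rewrite intrB; ring.
Qed.

Variable m : nat -> r.+1.-tuple int.
Hypothesis hm : best_approx_seq alpha m.

Lemma lim_sup_exceptional L : 
  cvgn (series (fun nu : nat =>
       ((height (m nu.+1))%:R : R) ^+ (r + k)%N
       * ln ((height (m nu.+1))%:R : R) ^+ (if k == 1%N then 1%N else 0%N)
       * zeta alpha (m nu))) ->
  lebesgue_tuple (lim_sup_set
    (fun i => exceptional L (height (m i.+1)) (zeta alpha (m i)))) = 0%E.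
Proof.
set d := (if _ then _ else _); set u := (fun nu => _) => cu.
have [_ mS] := hm.
(* The measure bound is available only for [e <= 1]; here [e] is at most a distance to the
   integers. *)
have m01 i : 0 <= zeta alpha (m i) <= 1.
  have /best_approxP[m0 -> h] := best_approx_seq_best hm i.
  by rewrite (le_trans (h (m i) _)) ?m0 ?leqnn ?dist_int_le1.
have M2 i : (2 <= height (m i.+1))%N.
  apply: leq_trans (mS i).
  by have /best_approxP[] := best_approx_seq_best hm i.
have ln2 : 0 < ln 2%:R ^+ d :> R by rewrite exprn_gt0// ln_gt0// ltr1n.
(* [ln M >= ln 2], so the logarithmic factor only changes the constant. *)
pose K : R := 3%:R ^+ (r + k) * (2 * L + 5)%:R ^+ k * 2 / ln 2%:R ^+ d.
have K0 : 0 <= K by rewrite divr_ge0 ?ltW// !mulr_ge0 ?exprn_ge0.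
have u0 i : 0 <= u i.
  have /andP[z0 _] := m01 i; rewrite /u !mulr_ge0 ?exprn_ge0// ln_ge0//.
  by rewrite ler1n ltnW.
have uK i : (lebesgue_tuple
    (exceptional L (height (m i.+1)) (zeta alpha (m i))) <= K%:E * (u i)%:E)%E.
  apply: (le_trans (exceptional_measure _ _ (m01 i))).
  have /andP[z0 _] := m01 i.
  (* The 3 in [K] comes from [2 * M + 1 <= 3 * M]. *)
  have h1 : (2 * height (m i.+1)).+1%:R ^+ (r + k) <=
      3%:R ^+ (r + k) * (height (m i.+1))%:R ^+ (r + k) :> R.
    rewrite -exprMn lerXn2r ?nnegrE ?mulr_ge0// -natrM ler_nat.
    by have := M2 i; lia.
  have h2 : ln 2%:R ^+ d <= ln (height (m i.+1))%:R ^+ d :> R.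
    rewrite lerXn2r ?nnegrE ?ln_ge0 ?ler1n//; first exact: ltnW.
    by rewrite ler_ln ?posrE ?ltr0n ?ler_nat//; exact: ltnW.
  rewrite -EFinM lee_fin /K /u.
  have key (X Y H P Q l z : R) : X <= Q * H -> l <= Y -> 0 < l -> 0 <= P ->
      0 <= Q -> 0 <= H -> 0 <= z ->
      X * (P * (2 * z)) <= Q * P * 2 / l * (H * Y * z).
    move=> XQ lY l0 P0 Q0 H0 z0'.
    have -> : Q * P * 2 / l * (H * Y * z) = Q * H * (P * (2 * z)) * (Y / l).
      by ring.
    apply: (@le_trans _ _ (Q * H * (P * (2 * z)))).
      by rewrite ler_wpM2r ?mulr_ge0.
    by rewrite ler_peMr ?mulr_ge0// ler_pdivlMr ?mul1r.
  by apply: key => //; exact: exprn_ge0.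
apply: lim_sup_set_cvg0.
  by move=> i; exact: measurable_exceptional.
apply: (@le_lt_trans _ _ (\sum_(n <oo) (K%:E * (u n)%:E))%E).
  by apply: lee_nneseries => // i _; exact: uK.
rewrite nneseriesZl//; last by move=> i _; rewrite lee_fin.
by rewrite lte_mul_pinfty// nneseries_EFin_lty.
Qed.

End exceptional.

Unset Implicit Arguments.
Set Strict Implicit.

Theorem theorem1 (R : realType) (r k : nat) (alpha : r.-tuple R)
    (m : nat -> r.+1.-tuple int)
    (hr : (1 <= r)%N) (hk : (1 <= k)%N)
    (halpha : lin_indep_Q alpha) (hm : best_approx_seq alpha m)
    (hcvg : cvgn (series (fun nu : nat =>
       ((height (m nu.+1))%:R : R) ^+ (r + k)%N
       * ln ((height (m nu.+1))%:R : R) ^+ (if k == 1%N then 1%N else 0%N)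
       * zeta alpha (m nu)))) :
  \forall beta \ae (@lebesgue_tuple R k),
    exists2 m' : nat -> (r + k).+1.-tuple int,
      best_approx_seq (cat_tuple alpha beta) m'
    & finite_set (range m' `+` range (fun nu => pad0 k (m nu))).
Proof.
(* The cubes of integer size [L] exhaust the space, so a countable union of null sets takes care of
   every [beta]. *)
pose E L i := exceptional (k := k) alpha L (height (m i.+1)) (zeta alpha (m i)).
have nE : (@lebesgue_tuple R k).-negligible (\bigcup_L lim_sup_set (E L)).
  apply: negligible_bigcup => L; exists (lim_sup_set (E L)); split=> //.
    apply: bigcapT_measurable => N; apply: bigcup_measurable => i _.
    exact: measurable_exceptional.
  exact: lim_sup_exceptional.
apply: negligibleS nE => beta; apply: contra_notP => nbeta.
pose L := \max_(j < k) Num.bound `|tnth beta j|.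
have bL j : `|tnth beta j| <= L%:R.
  apply: (le_trans (ltW (archi_boundP (normr_ge0 _)))).
  by rewrite ler_nat; exact: (leq_bigmax j).
(* Being outside the upper limit set means avoiding all sets from some index on, and that index is
   the [N] of the deterministic half. *)
have [N far] : exists N, forall i, (N <= i)%N -> ~ E L i beta.
  apply: contrapT => /forallNP h; apply: nbeta; exists L => // N _.
  apply: contrapT => nN; apply: (h N) => i Ni Ei; apply: nN; by exists i.
apply: (@best_approx_seq_extend _ _ _ _ _ _ hr halpha hm N).
move=> i n Ni nM tl; apply: notin_exceptional nM tl _ => //.
exact: far.
Qed.
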